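(* For every integer $i\ge 1$: (a) $\beta(G_i)=\infty$; and (b) $\beta(G_i')\le 2i+1$.
   Context: $\mathbb{N}$ denotes the nonnegative integers. For a connected graph $G$, finite or infinite, $d(u,v)$ is the number of edges of a shortest $u$--$v$ path. A vertex $w$ resolves $u,v$ if $d(u,w)\ne d(v,w)$; a set $W\subseteq V(G)$ is a resolving set if every two distinct vertices of $G$ are resolved by some $w\in W$. The metric dimension $\beta(G)$ is the minimum cardinality of a resolving set; $\beta(G)=\infty$ means that there is no finite resolving set. Let $V=\{v_{ij}: i\in\mathbb{N},\ j\in\{0,1\}\}$ (all $v_{ij}$ distinct). For $i\in\mathbb{N}$ define simple graphs $G_i=(V,E_i)$ and $G_i'=(V,E_i')$ as follows: distinct vertices $v_{ab}$, $v_{cd}$ are adjacent in $G_i$ iff $|a-c|\le i$; distinct vertices $v_{ab}$, $v_{cd}$ are adjacent in $G_i'$ iff either $|a-c|\le i$, or $|a-c|=i+1$ and $b\ne d$. Thus $E_0\subseteq E_0'\subseteq E_1\subseteq E_1'\subseteq\cdots$. *)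

(* Defs.v *)
From HB Require Import structures.
From mathcomp Require Import all_boot ssrint.
From mathcomp Require Import boolp classical_sets functions cardinality.

Set Implicit Arguments.
Unset Strict Implicit.
Unset Printing Implicit Defensive.

Local Open Scope nat_scope.

(* [None] stands for infinity, the minimum of the empty set. *)
Definition min_nat (P : nat -> Prop) : option nat :=
  if pselect (exists n, `[< P n >]) is left exP then Some (ex_minn exP)
  else None.

Lemma min_nat_SomeP (P : nat -> Prop) (n : nat) :
  min_nat P = Some n <-> P n /\ forall m, P m -> n <= m.
Proof.
rewrite /min_nat; case: pselect => [exP|nexP]; last first.
  by split=> // -[Pn _]; case: nexP; exists n; apply/asboolP.
case: ex_minnP => k /asboolP Pk kmin; split=> [[<-]|[Pn nmin]].
  by split=> // m Pm; apply: kmin; apply/asboolP.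
by congr Some; apply/eqP; rewrite eqn_leq kmin ?nmin //; apply/asboolP.
Qed.

Lemma min_nat_NoneP (P : nat -> Prop) :
  min_nat P = None <-> forall n, ~ P n.
Proof.
rewrite /min_nat; case: pselect => [exP|nexP].
  by split=> // nP; have [n /asboolP Pn] := exP; case: (nP n).
by split=> // _ n Pn; apply: nexP; exists n; apply/asboolP.
Qed.

Record sgraph := SGraph {
  vertex :> eqType;
  adj : rel vertex;
  adj_sym : symmetric adj;
  adj_irrefl : irreflexive adj
}.

Section MetricDimension.
Variable G : sgraph.
Implicit Types (u v w : G) (W : set G).

(* [u :: p] is the vertex sequence of the path, so [size p] counts its edges. *)
Definition has_path_of_length u v (n : nat) : Prop :=
  exists p : seq G,
    [/\ path (@adj G) u p, uniq (u :: p), last u p = v & size p = n].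

(* [None] when no path joins [u] and [v], which never happens in a connected
   graph. *)
Definition dist u v : option nat := min_nat (has_path_of_length u v).

Definition resolves w u v : Prop := dist u w <> dist v w.

Definition resolving_set W : Prop :=
  forall u v, u <> v -> exists2 w, W w & resolves w u v.

(* [None] is the value infinity: there is no finite resolving set. *)
Definition metric_dimension : option nat :=
  min_nat (fun n => exists2 W, resolving_set W & (W #= `I_n)%card).

End MetricDimension.

(* The pair [(a, b)] is the vertex v_{ab}, with b in {0,1} read as a boolean. *)
Definition V : Type := (nat * bool)%type.
HB.instance Definition _ := Choice.on V.

Definition adjG (i : nat) : rel V :=
  fun x y => (x != y) && (`|x.1 - y.1|%N <= i).

Definition adjG' (i : nat) : rel V :=
  fun x y => (x != y) &&
    ((`|x.1 - y.1|%N <= i) || ((`|x.1 - y.1|%N == i.+1) && (x.2 != y.2))).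

Lemma adjG_sym i : symmetric (adjG i).
Proof. by move=> x y; rewrite /adjG eq_sym distnC. Qed.

Lemma adjG_irrefl i : irreflexive (adjG i).
Proof. by move=> x; rewrite /adjG eqxx. Qed.

Lemma adjG'_sym i : symmetric (adjG' i).
Proof. by move=> x y; rewrite /adjG' eq_sym distnC (eq_sym x.2). Qed.

Lemma adjG'_irrefl i : irreflexive (adjG' i).
Proof. by move=> x; rewrite /adjG' eqxx. Qed.

Definition graphG (i : nat) : sgraph := SGraph (adjG_sym i) (adjG_irrefl i).
Definition graphG' (i : nat) : sgraph := SGraph (adjG'_sym i) (adjG'_irrefl i).

(* Main.v *)
(* (a) In [G_i] the vertices v_{a0} and v_{a1} are twins: exchanging them is an
   automorphism, so only these two vertices resolve them, and a resolving set
   meets every column.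

   (b) In [G_i'] a vertex in column distance D and bit difference e is within
   distance n iff D < n (i+1), or D = n (i+1) and e has the parity of n.  The
   2i+1 landmarks are v_{c0} with c <= i and v_{c1} with c < i; the other
   vertices are in columns a >= i.  Two such vertices in the same column a are
   resolved by v_{c0} with c = a mod (i+1).  If a < a' and c = a mod (i+1) < i,
   the bit d can be chosen so that v_{cd} attains its exceptional distance
   a / (i+1) on column a; if c = i, then d can be chosen so that v_{0d} does
   not attain it on column a'. *)
Require Import Defs.
From mathcomp Require Import all_boot.
From mathcomp Require Import ssrint zify.
From mathcomp Require Import boolp classical_sets functions cardinality.

Set Implicit Arguments.
Unset Strict Implicit.
Unset Printing Implicit Defensive.

Local Open Scope nat_scope.

Lemma min_nat_le (P : nat -> Prop) k :
  P k -> exists2 n, min_nat P = Some n & n <= k.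
Proof.
move=> Pk; case E: (min_nat P) => [n|]; last by have /min_nat_NoneP/(_ k) := E.
by exists n => //; have [_ ->] := (min_nat_SomeP P n).1 E.
Qed.

Lemma eq_min_nat (P Q : nat -> Prop) :
  (forall n, P n <-> Q n) -> min_nat P = min_nat Q.
Proof. by move=> PQ; congr min_nat; apply/funext => n; apply/propext. Qed.

Lemma dist_aut (G : sgraph) (s : G -> G) (u v : G) :
  involutive s -> (forall x y, adj (s x) (s y) = adj x y) ->
  dist (s u) (s v) = dist u v.
Proof.
move=> sK sadj; have s_inj := inv_inj sK.
have sP x y n : has_path_of_length x y n -> has_path_of_length (s x) (s y) n.
  case=> p [pP pU pL pS]; exists (map s p); split.
  - by rewrite path_map (eq_path (e' := @adj G)).
  - by rewrite -map_cons map_inj_uniq.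
  - by rewrite last_map pL.
  - by rewrite size_map.
apply: eq_min_nat => n; split=> [/sP|]; first by rewrite !sK.
exact: sP.
Qed.

Definition twin_swap (a : nat) (x : V) : V :=
  if x.1 == a then (x.1, ~~ x.2) else x.

Lemma twin_swapK a : involutive (twin_swap a).
Proof.
by case=> c b; rewrite /twin_swap /=; case ca: (c == a); rewrite /= ca ?negbK.
Qed.

Lemma twin_swap1 a x : (twin_swap a x).1 = x.1.
Proof. by rewrite /twin_swap; case: ifP. Qed.

Lemma twin_swap_adj i a x y :
  adjG i (twin_swap a x) (twin_swap a y) = adjG i x y.
Proof. by rewrite /adjG (inj_eq (inv_inj (@twin_swapK a))) !twin_swap1. Qed.

Lemma resolving_setG_column i (W : set (graphG i)) a :
  resolving_set W -> exists b : bool, W (a, b).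
Proof.
move=> /(_ (a, false) (a, true)) [//|[c b] Ww wP].
have [ca|ca] := eqVneq c a; first by exists b; rewrite -ca.
case: wP; rewrite -(dist_aut (G := graphG i) (a, false) (c, b)
  (@twin_swapK a) (twin_swap_adj i a)).
by rewrite /twin_swap /= eqxx (negPf ca).
Qed.

(** The columns of a finite resolving set would form a finite set containing all of [nat]. *)
Lemma metric_dimensionG i : metric_dimension (graphG i) = None.
Proof.
apply/min_nat_NoneP => n [W resW cardW].
have finW : finite_set (fst @` (W : set V)).
  by apply: finite_image; exists n.
apply: infinite_nat; apply: sub_finite_set finW => a _.
by have [b Wab] := resolving_setG_column a resW; exists (a, b).
Qed.

Definition ballG' (i n : nat) (x y : V) : bool :=
  (`|x.1 - y.1|%N < n * i.+1) ||
  (`|x.1 - y.1|%N == n * i.+1) && (x.2 (+) y.2 == odd n).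

Lemma ballG'0 i x y : ballG' i 0 x y = (x == y).
Proof.
case: x y => [a b] [c d]; rewrite /ballG' xpair_eqE /= mul0n distn_eq0.
by case: b d => [] [].
Qed.

Lemma ballG'_mono i k n x y : k <= n -> ballG' i k x y -> ballG' i n x y.
Proof.
rewrite leq_eqVlt => /orP[/eqP->//|kn]; rewrite /ballG'.
have lt : k * i.+1 < n * i.+1 by rewrite ltn_mul2r.
by case/orP => [/ltn_trans->|/andP[/eqP-> _]] //; rewrite lt.
Qed.

(** An edge moves the column by at most [i.+1], and by exactly that only if it flips the bit; so
    [size p] edges cover [size p * i.+1] columns only if each of them flips it. *)
Lemma ballG'_path i (x : V) p :
  path (adjG' i) x p -> ballG' i (size p) x (last x p).
Proof.
elim: p x => [|y p IH] x /=; first by rewrite /ballG' distnn addbb eqxx.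
case/andP => + /IH; set z := last y p; rewrite /adjG' /ballG' mulSn /=.
case/andP => _ + yz.
move: (leqD_dist x.1 y.1 z.1) => tri.
case/orP => [xy|/andP[/eqP xy bxy]].
  apply/orP; left; case/orP: yz => [|/andP[/eqP + _]]; lia.
case/orP: yz => [|/andP[/eqP yz /eqP byz]]; first by move=> ?; apply/orP; left; lia.
move: tri; rewrite xy yz leq_eqVlt => /orP[/eqP ->|->//].
rewrite eqxx /= -byz orbC; apply/orP; left.
by case: (x.2) (y.2) (z.2) bxy => [] [] [].
Qed.

(* The walk goes to the vertex at column distance [n * i.+1] from [y] that is
   exceptionally close to it, unless [x] is already within that distance. *)
Lemma ballG'_step i n x y : ballG' i n.+1 x y ->
  exists2 z, (z == x) || adjG' i x z & ballG' i n z y.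
Proof.
case: x y => [a b] [c d] xy.
have [near|far] := ltnP `|a - c|%N (n * i.+1).
  by exists (a, b); rewrite ?eqxx // /ballG' near.
(* The subtraction does not truncate: in that case [far] bounds [c - a] below by [n * i.+1]. *)
exists (if c <= a then c + n * i.+1 else c - n * i.+1, d (+) odd n); last first.
  rewrite /ballG' /= addbAC addbb eqxx andbT.
  by apply/orP; right; case: ifP => ca; lia.
rewrite eq_sym /adjG'; case: eqVneq => //= _.
move: xy; rewrite /ballG' mulSn /=; move: (n * i.+1) far => N far.
case/orP => [|/andP[D /eqP bd]].
  by move=> ?; apply/orP; left; case: ifP => ?; lia.
apply/orP; right; apply/andP; split; first by case: ifP => ?; lia.
by case: b d (odd n) bd => [] [] [].
Qed.

Lemma ballG'P i n (x y : graphG' i) :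
  ballG' i n x y <-> exists2 k, k <= n & has_path_of_length x y k.
Proof.
split; last first.
  case=> k kn [p [pP _ <- pS]]; apply: ballG'_mono kn _.
  by rewrite -pS; apply: ballG'_path.
move=> xy.
have [p pP [pL pS]] : exists2 p, path (adjG' i) x p & last x p = y /\ size p <= n.
  elim: n x xy => [|n IH] x; last first.
    move=> /ballG'_step[z xz /IH[p pP [pL pS]]].
    case/orP: xz => [/eqP zx|xz]; first by exists p; rewrite -?zx //; split=> //; lia.
    by exists (z :: p); rewrite /= ?xz.
  by rewrite ballG'0 => /eqP->; exists [::].
(* The walk [p] is not known to be repetition-free; cutting out its cycles can only shorten it. *)
case/shortenP: pP pL => q qP qU qs qL; exists (size q); last by exists q.
by apply: leq_trans pS; apply: uniq_leq_size qs; case/andP: qU.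
Qed.

(** Vertices equidistant from [w] lie in the same balls around [w], so one separating ball suffices
    and no distance has to be computed. *)
Lemma ballG'_resolves i n (u v w : graphG' i) :
  ballG' i n u w != ballG' i n v w -> resolves w u v.
Proof.
move=> uv duv; move/eqP: uv; apply.
suff {u v duv} sub u v : dist u w = dist v w -> ballG' i n u w -> ballG' i n v w.
  by apply/idP/idP; apply: sub.
move=> duv /ballG'P[k kn /min_nat_le[m + mk]].
rewrite -/(dist u w) duv => /min_nat_SomeP[vw _].
by apply/ballG'P; exists m => //; apply: leq_trans kn.
Qed.

(* Listing the vertices column by column, these are the first [2 * i + 1]. *)
Definition landmarks (i : nat) : set V :=
  [set w : V | w.1.*2 + w.2 < 2 * i + 1]%classic.

Lemma card_landmarks i : (landmarks i #= `I_(2 * i + 1))%card.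
Proof.
pose f k : V := (k./2, odd k).
have fK k : (f k).1.*2 + (f k).2 = k by rewrite addnC odd_double_half.
have -> : landmarks i = (f @` `I_(2 * i + 1))%classic.
  apply/seteqP; split=> [[c d] cd|_ [k kn <-]]; last by rewrite /landmarks /= fK.
  exists (c.*2 + d) => //; rewrite /f addnC half_bit_double oddD odd_double addbF.
  by case: (d).
by apply: inj_card_eq => k l _ _ kl; rewrite -(fK k) kl fK.
Qed.

Lemma resolving_landmarks i : 0 < i ->
  resolving_set (landmarks i : set (graphG' i)).
Proof.
move=> i_gt0.
suff col_le (u v : graphG' i) : u.1 <= v.1 -> u <> v ->
    exists2 w : graphG' i, landmarks i w & resolves w u v.
  move=> u v uv; have [le|/ltnW le] := leqP u.1 v.1; first exact: col_le.
  have [w Ww wP] := col_le _ _ le (nesym uv).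
  by exists w => // vuw; apply: wP.
case: u v => [a b] [a' b'] /= aa' uv.
have [ul|/negP ul] := boolP (a.*2 + b < 2 * i + 1).
  exists (a, b) => //; apply: (@ballG'_resolves i 0); rewrite !ballG'0 eqxx.
  by apply/eqP => /esym/eqP/esym.
have [vl|/negP vl] := boolP (a'.*2 + b' < 2 * i + 1).
  exists (a', b') => //; apply: (@ballG'_resolves i 0); rewrite !ballG'0 eqxx.
  by apply/eqP => /eqP.
have ia : i <= a by move: ul; case: (b); lia.
have [n [c [ci aE]]] : exists n c, c < i.+1 /\ a = n * i.+1 + c.
  by exists (a %/ i.+1), (a %% i.+1); rewrite ltn_pmod // -divn_eq.
have bb' : a = a' -> b' = ~~ b.
  by move=> aa; case: b b' uv {ul vl} => [] []; rewrite aa.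
have [ltci|leic] := ltnP c i.
  exists (c, b (+) odd n).
    by rewrite /landmarks /=; case: (_ (+) _); lia.
  apply: (@ballG'_resolves i n); rewrite /ballG' /= addKb.
  have -> : `|a - c| = n * i.+1 by lia.
  rewrite !eqxx orbT; move: aa'; rewrite leq_eqVlt => /orP[/eqP aa|aa].
    have -> : `|a' - c| = n * i.+1 by lia.
    by rewrite bb' // eqxx ltnn; case: (b) (odd n) => [] [].
  by apply/eqP => /esym/orP[|/andP[/eqP]]; lia.
have {leic ci} cE : c = i by lia.
move: aa'; rewrite leq_eqVlt => /orP[/eqP aa|aa].
  (* The two bits in column [a] are opposite, so exactly one of them has the parity of [n]. *)
  exists (i, false); first by rewrite /landmarks /=; lia.
  apply: (@ballG'_resolves i n); rewrite /ballG' /= (bb' aa) -aa.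
  have -> : `|a - i| = n * i.+1 by lia.
  by rewrite eqxx ltnn; case: (b) (odd n) => [] [].
(* Here [a < n.+1 * i.+1 <= a'], so the ball of radius [n.+1] holds the first vertex; the second has
   bit difference [odd n], the wrong parity for its boundary. As [i] is positive, both bits of
   column 0 are landmarks. *)
exists (0, b' (+) odd n).
  by rewrite /landmarks /=; case: (_ (+) _); lia.
apply: (@ballG'_resolves i n.+1); rewrite /ballG' /= addKb.
have -> : `|a - 0| < n.+1 * i.+1 by lia.
apply/eqP => /esym/orP[|/andP[_]]; first by lia.
by case: (odd n).
Qed.

Theorem theorem2p1 (i : nat) (i_ge1 : 1 <= i) :
  metric_dimension (graphG i) = None /\
  exists2 n : nat, metric_dimension (graphG' i) = Some n & n <= 2 * i + 1.
Proof.
split; first exact: metric_dimensionG.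
apply: min_nat_le; exists (landmarks i); first exact: resolving_landmarks.
exact: card_landmarks.
Qed.
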